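(* Let $p=p(n)\in[0,1]$ satisfy $p\gg n^{-1}$, i.e. $n\,p(n)\to\infty$ as $n\to\infty$, and let $G\in\mathcal{G}(n,p)$. Then asymptotically almost surely $$\operatorname{td}(G)=n-O\left(\sqrt{\frac{n}{p}}\right),$$ that is, there is a constant $C>0$ such that $\Pr\left(n-C\sqrt{n/p}\le \operatorname{td}(G)\le n\right)\to 1$ as $n\to\infty$.
   Context: All graphs are finite and simple. $\mathcal{G}(n,p)$ is the Erdős–Rényi random graph on $n$ labeled vertices in which each pair of vertices is an edge independently with probability $p$. A property holds asymptotically almost surely (a.a.s.) if its probability tends to $1$ as $n\to\infty$. Tree-depth: the closure of a rooted tree $T$ is the graph on the vertex set of $T$ in which two distinct vertices are adjacent iff one is an ancestor of the other in $T$. A rooted forest is a disjoint union of rooted trees, and its closure is the disjoint union of the closures of its trees. The height of a rooted tree is the maximum number of vertices on a path from the root to a vertex, and the height of a rooted forest is the maximum height of its trees. The tree-depth $\operatorname{td}(G)$ of a graph $G$ is the minimum height of a rooted forest $F$ on the vertex set $V(G)$ such that $G$ is a subgraph of the closure of $F$. (With this convention $\operatorname{td}(K_n)=n$.) *)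

(* Defs.v *)
From HB Require Import structures.
From mathcomp Require Import all_boot all_order all_algebra.

Set Implicit Arguments.
Unset Strict Implicit.
Unset Printing Implicit Defensive.

Import Order.TTheory GRing.Theory Num.Theory.

Section Graphs.
Variable T : finType.

Definition vpairs : {set {set T}} := [set e : {set T} | #|e| == 2].

(* A simple graph on T is a set of unordered pairs of distinct vertices. *)
Record sgraph := SGraph {
  edges : {set {set T}};
  edges_sub : edges \subset vpairs }.

HB.instance Definition _ := [isSub for edges].
HB.instance Definition _ := [Finite of sgraph by <:].

Definition adj (G : sgraph) : rel T := fun x y => [set x; y] \in edges G.

(* A rooted forest on T is given by its parent map: [f x = Some y] when y is
   the parent of x, and [f x = None] when x is a root. *)
Section Forest.
Variable f : {ffun T -> option T}.

Definition parent_rel : rel T := fun x y => f x == Some y.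

Definition ancestor_or_self (y x : T) : bool := connect parent_rel x y.

Definition proper_ancestor (y x : T) : bool :=
  [exists z, parent_rel x z && ancestor_or_self y z].

(* As T is finite, the absence of cycles ensures that iterating the parent map
   from any vertex ends at a root. *)
Definition is_forest : bool := [forall x, ~~ proper_ancestor x x].

Definition closure_adj : rel T :=
  fun x y => (x != y) && (proper_ancestor x y || proper_ancestor y x).

(* The vertices on the path from the root to x are exactly the ancestors of x
   together with x itself. *)
Definition root_path (x : T) : {set T} := [set y | ancestor_or_self y x].

Definition forest_height : nat := \max_(x : T) #|root_path x|.

Definition in_closure (G : sgraph) : bool :=
  [forall x, forall y, adj G x y ==> closure_adj x y].

End Forest.

Definition has_td_forest (G : sgraph) (h : nat) : bool :=
  [exists f : {ffun T -> option T},
    [&& is_forest f, in_closure f G & forest_height f == h]].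

Definition path_forest : {ffun T -> option T} :=
  [ffun x => if (enum_rank x : nat) is k.+1
             then omap enum_val (insub k : option 'I_#|T|) else None].

Lemma path_forest_parent x y :
  parent_rel path_forest x y = (enum_rank x == (enum_rank y).+1 :> nat).
Proof.
rewrite /parent_rel ffunE.
case E: (enum_rank x : nat) => [|k] //=.
have kT : k < #|T| by apply: ltn_trans (ltn_ord (enum_rank x)); rewrite E.
rewrite insubT /= eqSS; apply/eqP/eqP => [[<-]|kE].
  by rewrite enum_valK.
by congr Some; apply: enum_rank_inj; rewrite enum_valK; apply: val_inj.
Qed.

Lemma path_forest_ancestor x y :
  ancestor_or_self path_forest y x = (enum_rank y <= enum_rank x).
Proof.
apply/idP/idP => [/connectP[s]|].
  elim: s x => [|z s IHs] x /=; first by move=> _ ->.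
  rewrite path_forest_parent => /andP[/eqP-> sP] /(IHs _ sP).
  exact: leqW.
move: {2}(enum_rank x : nat) (erefl (enum_rank x : nat)) => k.
elim: k x => [|k IHk] x xE.
  rewrite xE leqn0 => /eqP yE; rewrite /ancestor_or_self.
  suff -> : x = y by exact: connect0.
  by apply: enum_rank_inj; apply: val_inj; rewrite /= xE yE.
rewrite xE leq_eqVlt => /orP[/eqP yE|].
  rewrite /ancestor_or_self; suff -> : x = y by exact: connect0.
  by apply: enum_rank_inj; apply: val_inj; rewrite /= xE yE.
rewrite ltnS => yk.
have kT : k < #|T| by apply: ltn_trans (ltn_ord (enum_rank x)); rewrite xE.
have zE : enum_rank (enum_val (Ordinal kT)) = k :> nat by rewrite enum_valK.
apply: (@connect_trans _ _ (enum_val (Ordinal kT))).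
  by apply: connect1; rewrite path_forest_parent xE zE.
by apply: IHk => //; rewrite zE.
Qed.

Lemma path_forest_proper x y :
  proper_ancestor path_forest y x = (enum_rank y < enum_rank x).
Proof.
apply/existsP/idP => [[z]|yx].
  by rewrite path_forest_parent path_forest_ancestor => /andP[/eqP->].
have kT : (enum_rank x).-1 < #|T|.
  by apply: leq_ltn_trans (leq_pred _) (ltn_ord (enum_rank x)).
exists (enum_val (Ordinal kT)).
rewrite path_forest_parent path_forest_ancestor enum_valK /=.
by move: yx; case: (enum_rank x : nat) => //= k; rewrite eqxx ltnS.
Qed.

Lemma has_td_forest_ex (G : sgraph) : exists h, has_td_forest G h.
Proof.
exists (forest_height path_forest); apply/existsP; exists path_forest.
rewrite eqxx andbT; apply/andP; split.
  by apply/forallP => x; rewrite path_forest_proper ltnn.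
apply/forallP => x; apply/forallP => y; apply/implyP => xy.
have xDy : x != y.
  apply/eqP => xE; have /subsetP/(_ _ xy) := edges_sub G.
  by rewrite inE xE setUid cards1.
rewrite /closure_adj xDy !path_forest_proper -neq_ltn /=.
by apply: contraNneq xDy => /val_inj/enum_rank_inj->.
Qed.

Definition treedepth (G : sgraph) : nat := ex_minn (has_td_forest_ex G).

End Graphs.

Local Open Scope ring_scope.

(* Each pair of vertices is an edge independently with probability p. *)
Definition gnp_mass (R : numDomainType) (n : nat) (p : R) (G : sgraph 'I_n) : R :=
  \prod_(e in vpairs 'I_n) (if e \in edges G then p else 1 - p).

Definition gnp_prob (R : numDomainType) (n : nat) (p : R)
    (A : pred (sgraph 'I_n)) : R :=
  \sum_(G : sgraph 'I_n | A G) gnp_mass p G.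

(* Main.v *)
Require Import Defs.
From mathcomp Require Import all_boot all_order all_algebra.
From mathcomp Require Import lra zify.

(** If a rooted forest on n vertices has height h, a depth-first traversal of
    it moves vertices one at a time from "unvisited" to the current root path,
    and from there to "finished". At the moment when as many vertices are
    finished as unvisited, there are m >= (n - h)/2 of each, and no finished
    vertex is comparable to an unvisited one. So a graph with
    td(G) < n - 4 sqrt(n/p) has disjoint sets S, U of equal size
    m > 2 sqrt(n/p) with no edge between them. For given S and U this has
    probability (1 - p)^(m^2) <= exp(-4n), and there are at most 4^n pairs. *)

Set Implicit Arguments.
Unset Strict Implicit.
Unset Printing Implicit Defensive.

Import Order.TTheory GRing.Theory Num.Theory.

(** * Depth-first traversal of a rooted forest *)

Section ForestSeparation.
Variables (T : finType) (f : {ffun T -> option T}).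
Hypothesis forest_f : is_forest f.

Lemma ancestor_or_selfE x y :
  ancestor_or_self f y x =
  (y == x) || (if f x is Some z then ancestor_or_self f y z else false).
Proof.
apply/idP/idP => [/connectP[[|z s] /=]|].
- by move=> _ ->; rewrite eqxx.
- rewrite /parent_rel => /andP[/eqP -> zs] yE; apply/orP; right.
  by apply/connectP; exists s.
case/orP => [/eqP ->|]; first exact: connect0.
case fx: (f x) => [z|//]; apply: connect_trans.
by apply: connect1; rewrite /parent_rel fx.
Qed.

Lemma proper_ancestorE x y :
  proper_ancestor f y x =
  (if f x is Some z then ancestor_or_self f y z else false).
Proof.
apply/existsP/idP => [[z /andP[/eqP -> //]]|].
by case fx: (f x) => [z|//] yz; exists z; rewrite /parent_rel fx eqxx.
Qed.

(** The empty value at [None] lets a root and a child be pushed or popped by the same equation. *)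
Definition stack (t : option T) : {set T} :=
  if t is Some x then root_path f x else set0.

Lemma root_path_parent x : root_path f x = x |: stack (f x).
Proof.
apply/setP => y; rewrite !inE ancestor_or_selfE.
by case: (f x) => [z|]; rewrite !inE.
Qed.

Lemma notin_stack_parent x : x \notin stack (f x).
Proof.
have /forallP/(_ x) := forest_f; rewrite proper_ancestorE.
by case: (f x) => [z|]; rewrite !inE.
Qed.

Definition down_closed (S : {set T}) :=
  forall x z, f x = Some z -> z \in S -> x \in S.

Lemma down_closedP S x y :
  down_closed S -> ancestor_or_self f y x -> y \in S -> x \in S.
Proof.
move=> dS /connectP[s]; elim: s x => [x _ -> //|z s IH x /=].
by rewrite /parent_rel => /andP[/eqP fx zs] yE yS; apply: (dS x z fx); apply: IH.
Qed.

(** If [x] and [y] were comparable, the lower one would be a descendant of the other and so lie in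
    both sets. *)
Lemma down_closed_disjoint S U x y :
  down_closed S -> down_closed U -> [disjoint S & U] ->
  x \in S -> y \in U -> ~~ closure_adj f x y.
Proof.
move=> dS dU /pred0P SU xS yU; apply/negP => /andP[_].
rewrite !proper_ancestorE => /orP[] anc.
- have xy : ancestor_or_self f x y by rewrite ancestor_or_selfE anc orbT.
  by have := SU y; rewrite /= yU (down_closedP dS xy xS).
- have yx : ancestor_or_self f y x by rewrite ancestor_or_selfE anc orbT.
  by have := SU x; rewrite /= xS (down_closedP dU yx yU).
Qed.

(* [S]: finished, [U]: unvisited, [t]: top of the stack, where [None] plays the
   part of a virtual parent of all the roots. *)
Record traversal (S U : {set T}) (t : option T) : Prop := Traversal {
  finished_down : down_closed S;
  unvisited_down : down_closed U;
  finished_unvisited : [disjoint S & U];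
  traversal_stack : ~: (S :|: U) = stack t }.

(** [U :\ y] stays closed under children because the parent of [y], if any, is on the stack and so
    outside [U]. *)
Lemma traversal_push S U y :
  traversal S U (f y) -> y \in U -> traversal S (U :\ y) (Some y).
Proof.
case=> dS dU SU st yU.
have yS : y \notin S by apply/negP => yS; have /pred0P/(_ y) := SU; rewrite /= yS yU.
split=> //.
- move=> x z fx; rewrite !inE => /andP[zy zU]; rewrite (dU x z fx zU) andbT.
  apply/eqP => xy; have : z \in stack (f y).
    by rewrite -xy fx inE ancestor_or_selfE eqxx.
  by rewrite -st !inE zU orbT.
- by apply: disjointWr SU; exact: subD1set.
- rewrite /= root_path_parent -st; apply/setP => x; rewrite !inE.
  by case: eqP => [->|] //=; rewrite (negbTE yS).
Qed.

(** A child of [x] is not unvisited, and by acyclicity it is not on the root path of [x]; so it is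
    finished, and [x] may join [S]. *)
Lemma traversal_pop S U x :
  traversal S U (Some x) -> (forall y, f y = Some x -> y \notin U) ->
  traversal (x |: S) U (f x).
Proof.
case=> dS dU SU st nU.
have : x \in stack (Some x) by rewrite inE ancestor_or_selfE eqxx.
rewrite -st !inE => /norP[xS xU].
split=> //.
- move=> y z fy; rewrite !inE => /orP[/eqP zx|zS]; last by rewrite (dS y z fy zS) orbT.
  move: fy; rewrite zx => fy; apply/orP; right; apply: contraT => yS.
  have : y \in stack (Some x) by rewrite -st !inE negb_or yS nU.
  have := notin_stack_parent y; rewrite fy /= => /negbTE -> //.
- by rewrite -setI_eq0 setIUl setU_eq0 !setI_eq0 disjoints1 xU SU.
- have := st; rewrite /= root_path_parent => /setP st'.
  apply/setP => y; have := st' y; rewrite !inE.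
  case: eqP => [->|] //= _; by rewrite (negbTE (notin_stack_parent x)).
Qed.

(** Climb from any unvisited vertex: with an empty stack its parent lies in [S] or [U], and a parent
    in [S] would force the vertex into [S]. *)
Lemma traversal_next_root S U :
  traversal S U None -> U != set0 -> exists2 y, y \in U & f y = None.
Proof.
case=> dS dU SU st /set0Pn[u uU].
have [n] := ubnP #|root_path f u|; elim: n u uU => // n IH u uU le_n.
case fu: (f u) => [z|]; last by exists u.
apply: (IH z).
- have : z \notin ~: (S :|: U) by rewrite st inE.
  rewrite !inE negbK => /orP[zS|//].
  by have /pred0P/(_ u) := SU; rewrite /= uU (dS u z fu zS).
- move: le_n; rewrite (root_path_parent u) cardsU1 notin_stack_parent fu /=.
  by rewrite add1n ltnS.
Qed.

Lemma balanced_traversal : exists S U t, traversal S U t /\ #|S| = #|U|.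
Proof.
(* The measure counts the moves left: two for an unvisited vertex, one for a vertex on the stack. *)
suff go n (S U : {set T}) t : #|U|.*2 + #|stack t| < n -> #|S| <= #|U| ->
    traversal S U t -> exists S U t, traversal S U t /\ #|S| = #|U|.
  apply: (go _ set0 setT None (ltnSn _)); first by rewrite cards0.
  split; try by move=> x z _; rewrite !inE.
  - by apply/pred0P => x; rewrite /= inE.
  - by rewrite set0U setCT.
(* Either move decreases 2|U| + |stack| by 1 and |U| - |S| by 1. *)
elim: n S U t => // n IH S U t le_n; rewrite leq_eqVlt => /orP[/eqP SU tr|SU tr].
  by exists S, U, t.
have push y : y \in U -> f y = t -> exists S U t, traversal S U t /\ #|S| = #|U|.
  move=> yU fy; rewrite -fy in tr.
  have cU : #|U| = #|U :\ y|.+1 by rewrite (cardsD1 y U) yU.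
  apply: (IH S (U :\ y) (Some y)); last exact: traversal_push.
  - rewrite /= root_path_parent cardsU1 notin_stack_parent fy.
    by move: le_n; rewrite cU; lia.
  - by move: SU; rewrite cU ltnS.
have [y /andP[yU /eqP fy]|noy] := pickP (fun y => (y \in U) && (f y == t)).
  exact: push fy.
case: t => [x|] in le_n tr push noy *.
- apply: (IH (x |: S) U (f x)) => //.
  + move: le_n; rewrite /= root_path_parent cardsU1 notin_stack_parent; lia.
  + by rewrite cardsU1; case: (_ \notin _); lia.
  + apply: traversal_pop => // y fy; apply/negP => yU.
    by have := noy y; rewrite yU fy eqxx.
(* Nothing can be popped here, but [U] is nonempty since it is larger than [S], so some root can be
   pushed. *)
- have [|y yU fy] := traversal_next_root tr; last exact: push fy.
  by rewrite -card_gt0; lia.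
Qed.

End ForestSeparation.

(** * From tree-depth to a balanced separation *)

Definition no_edge_between (T : finType) (S U : {set T}) (G : sgraph T) : bool :=
  [forall x in S, forall y in U, ~~ adj G x y].

Lemma treedepth_separation (T : finType) (G : sgraph T) :
  exists S U : {set T}, [/\ [disjoint S & U], #|S| = #|U|,
    #|T| <= treedepth G + #|S|.*2 & no_edge_between S U G].
Proof.
rewrite /treedepth; case: ex_minnP => h /existsP[f /and3P[ff /forallP fG /eqP fh]] _.
have [S [U [t [[dS dU SU st] cSU]]]] := balanced_traversal ff.
exists S, U; split=> //.
(* All vertices outside [S] and [U] form one root path, which has at most [h] vertices. *)
- have := cardsC (S :|: U); rewrite st cardsU (disjoint_setI0 SU) cards0 subn0 -cSU.
  have : #|stack f t| <= h.
    rewrite -fh; case: t {st} => [x|]; last by rewrite cards0.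
    exact: (leq_bigmax x).
  by lia.
- apply/forallP => x; apply/implyP => xS; apply/forallP => y; apply/implyP => yU.
  move: (fG x) => /forallP/(_ y)/implyP GC; apply: contra GC _.
  exact: down_closed_disjoint dS dU SU xS yU.
Qed.

Lemma treedepth_le_card (T : finType) (G : sgraph T) : treedepth G <= #|T|.
Proof.
rewrite /treedepth; case: ex_minnP => h /existsP[f /and3P[_ _ /eqP <-]] _.
by apply/bigmax_leqP => x _; exact: max_card.
Qed.

Local Open Scope ring_scope.

(** * Probabilities in the random graph *)

Section GnpProbability.
Variables (R : numDomainType) (n : nat) (p : R).
Hypothesis p01 : 0 <= p <= 1.

Lemma gnp_mass_ge0 (G : sgraph 'I_n) : 0 <= gnp_mass p G.
Proof.
have /andP[p0 p1] := p01.
by apply: prodr_ge0 => e _; case: ifP; rewrite ?subr_ge0.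
Qed.

Lemma gnp_prob_avoid (E : {set {set 'I_n}}) : E \subset vpairs 'I_n ->
  gnp_prob p (fun G => [disjoint edges G & E]) = (1 - p) ^+ #|E|.
Proof.
move=> /subsetP EV; set V := vpairs 'I_n in EV *.
(* [F] weighs the presence of [e] and [F'] its absence. Expanding the product of [F e + F' e] gives
   a sum over sets [J], whose nonzero terms come only from edge sets avoiding [E]. *)
pose F e := if (e \in V) && (e \notin E) then p else 0.
pose F' e := if e \in V then 1 - p else 1.
transitivity (\prod_e (F e + F' e)); last first.
  rewrite -prodr_const [RHS]big_mkcond; apply: eq_bigr => e _; rewrite /F /F'.
  have [eE|eE] := boolP (e \in E); first by rewrite (EV e eE) andbF add0r.
  by case: (e \in V); rewrite /= ?add0r // addrC subrK.
rewrite bigA_distr (bigID (fun J : {set _} => (J \subset V) && [disjoint J & E])) /=.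
rewrite [X in _ = _ + X]big1 ?addr0; last first.
  move=> J; rewrite negb_and => /orP[/subsetPn[e eJ eV]|/pred0Pn[e /andP[/= eJ eE]]].
    by rewrite (bigD1 e) //= eJ /F (negbTE eV) mul0r.
  by rewrite (bigD1 e) //= eJ /F eE andbF mul0r.
rewrite (reindex_omap (@edges 'I_n) insub) /=; last first.
  by move=> J /andP[JV _]; rewrite insubT.
apply: eq_big => [G|G GE].
  by rewrite (edges_sub G) (valK G) eqxx andbT.
rewrite /gnp_mass big_mkcond; apply: eq_bigr => e _; rewrite /F /F'.
have [eG|eG] := boolP (e \in edges G); last by [].
rewrite (subsetP (edges_sub G) e eG) /=.
by have /pred0P/(_ e) := GE; rewrite /= eG /= => ->.
Qed.

Lemma gnp_prob_setT : gnp_prob p (@predT (sgraph 'I_n)) = 1.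
Proof.
have := gnp_prob_avoid (sub0set (vpairs 'I_n)).
rewrite cards0 expr0 => <-; apply: eq_bigl => G.
by apply/esym/pred0P => e; rewrite /= inE andbF.
Qed.

Lemma gnp_probC (A : pred (sgraph 'I_n)) :
  gnp_prob p A = 1 - gnp_prob p (predC A).
Proof. by rewrite -gnp_prob_setT /gnp_prob [X in X - _](bigID A) addrK. Qed.

Lemma gnp_prob_le (A B : pred (sgraph 'I_n)) :
  subpred A B -> gnp_prob p A <= gnp_prob p B.
Proof.
move=> AB; rewrite /gnp_prob big_mkcond [leRHS]big_mkcond.
apply: ler_sum => G _; case: ifP => [/AB -> //|_].
by case: ifP => _ //; exact: gnp_mass_ge0.
Qed.

Lemma gnp_prob_union (I : finType) (B : I -> pred (sgraph 'I_n)) (P : pred I) :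
  gnp_prob p (fun G => [exists i, P i && B i G]) <= \sum_(i | P i) gnp_prob p (B i).
Proof.
rewrite /gnp_prob; under [leRHS]eq_bigr => i _ do rewrite big_mkcond.
rewrite exchange_big big_mkcond; apply: ler_sum => G _.
have mass0 i : 0 <= (if B i G then gnp_mass p G else 0).
  by case: ifP => // _; exact: gnp_mass_ge0.
case: ifP => [/existsP[i /andP[Pi BiG]]|_]; last by rewrite sumr_ge0.
by rewrite (bigD1 i) //= BiG lerDl sumr_ge0.
Qed.

Lemma gnp_prob_no_edge_between (S U : {set 'I_n}) : [disjoint S & U] ->
  gnp_prob p (no_edge_between S U) = (1 - p) ^+ (#|S| * #|U|).
Proof.
move=> SU.
have nU x : x \in S -> x \in U = false by exact: disjointFr.
pose E := [set [set x; y] | x in S, y in U].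
(* Disjointness makes [x] and [y] recoverable from the unordered pair. *)
have cE : #|E| = (#|S| * #|U|)%N.
  rewrite /E curry_imset2X card_in_imset ?cardsX // => -[x y] [x' y'].
  rewrite !inE /= => /andP[/= xS yU] /andP[/= x'S y'U] /setP e.
  have := e x; have := e y; rewrite !inE !eqxx orbT /=.
  have -> : (y == x') = false by apply: contraTF yU => /eqP ->; rewrite nU.
  have -> : (x == y') = false by apply: contraTF y'U => /eqP <-; rewrite nU.
  by rewrite orbF /= => /esym/eqP -> /esym/eqP ->.
rewrite -cE -gnp_prob_avoid; last first.
  apply/subsetP => _ /imset2P[x y xS yU ->]; rewrite inE cards2.
  by rewrite eqSS eqb1; apply: contraTneq yU => <-; rewrite nU.
apply: eq_bigl => G; apply/forall_inP/idP => [noE|/pred0P dE x xS].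
  apply/pred0P => e /=; apply/negP => /andP[eG /imset2P[x y xS yU exy]].
  by have /forall_inP/(_ y yU) := noE x xS; rewrite /adj -exy eG.
apply/forall_inP => y yU; apply/negP => xyG.
have xyE : [set x; y] \in E by apply/imset2P; exists x y.
by have := dE [set x; y]; rewrite /= xyE andbT => /negbT/negP.
Qed.

End GnpProbability.

From mathcomp Require Import all_classical all_reals all_analysis.

Import numFieldNormedType.Exports.

Local Open Scope classical_set_scope.

(** * Exponential tail bound for the tree-depth *)

Section TreedepthTail.
Variables (R : realType) (n : nat) (p : R).
Hypotheses (p_gt0 : 0 < p) (p_le1 : p <= 1).

(** Here [1 - p <= expR (- p)] and [p * m^2 >= 4 * n]. The 5 comes from [expR 4 >= 1 + 4]; it
    exceeds the 4 in the count of pairs. *)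
Lemma no_edge_between_exp_bound (m : nat) :
  2 * Num.sqrt (n%:R / p) <= m%:R -> (1 - p) ^+ (m * m) <= 5^-1 ^+ n.
Proof.
move=> lm; have p0 := ltW p_gt0.
have np0 : 0 <= n%:R / p by rewrite divr_ge0.
have m2 : 4 * n%:R <= p * (m * m)%:R.
  have : (2 * Num.sqrt (n%:R / p)) ^+ 2 <= m%:R ^+ 2.
    by rewrite ler_pXn2r // nnegrE ?mulr_ge0 ?sqrtr_ge0.
  rewrite exprMn sqr_sqrtr // natrM -expr2 => le4.
  have := ler_wpM2l p0 le4; rewrite mulrCA (mulrCA p) mulfV ?gt_eqF //.
  by rewrite mulr1 => /(le_trans _) -> //; rewrite -natrX.
apply: (@le_trans _ _ (expR (- p) ^+ (m * m))).
  by rewrite lerXn2r ?nnegrE ?subr_ge0 ?expR_ge0 ?expR_ge1Dx.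
apply: (@le_trans _ _ (expR (- 4) ^+ n)).
  by rewrite -!expRM_natl ler_expR !mulrN lerN2 mulrC (mulrC _ p).
rewrite lerXn2r ?nnegrE ?expR_ge0 ?invr_ge0 //.
rewrite expRN lef_pV2 ?posrE ?expR_gt0 //.
by have := expR_ge1Dx (4 : R); lra.
Qed.

Lemma treedepth_tail :
  gnp_prob p (fun G : sgraph 'I_n =>
      (treedepth G)%:R < n%:R - 4 * Num.sqrt (n%:R / p)) <= (4 / 5) ^+ n.
Proof.
have p01 : 0 <= p <= 1 by rewrite ltW.
pose P (SU : {set 'I_n} * {set 'I_n}) := [&& [disjoint SU.1 & SU.2],
  #|SU.1| == #|SU.2| & 2 * Num.sqrt (n%:R / p) <= #|SU.1|%:R].
pose B (SU : {set 'I_n} * {set 'I_n}) := no_edge_between SU.1 SU.2.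
apply: (le_trans (gnp_prob_le p01
  (B := fun G => [exists SU, P SU && B SU G]) _)).
  move=> G; have [S [U [SU cSU le_n noE]]] := treedepth_separation G => lt_td.
  apply/existsP; exists (S, U); rewrite /P /B /= SU cSU eqxx noE andbT /=.
  (* Twice the size of [S] is at least [n] minus the tree-depth, hence above [4 * sqrt (n / p)]. *)
  move: le_n; rewrite card_ord -(ler_nat R) natrD -muln2 natrM cSU.
  by lra.
apply: (le_trans (gnp_prob_union p01 B P)).
apply: (@le_trans _ _ (\sum_(SU | P SU) 5^-1 ^+ n)).
  apply: ler_sum => -[S U] /and3P[/= SU /eqP cSU le_m].
  by rewrite gnp_prob_no_edge_between // -cSU no_edge_between_exp_bound.
rewrite sumr_const -[leLHS]mulr_natl exprMn ler_wpM2r ?exprn_ge0 ?invr_ge0 //.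
(* There are [2^n * 2^n = 4^n] pairs of vertex sets. *)
rewrite -natrX ler_nat (leq_trans (max_card _)) // card_prod.
by rewrite -[#|{set _}|]cardsT -powersetT card_powerset cardsT card_ord -expnMn.
Qed.

End TreedepthTail.

(** * The asymptotic statement *)

Theorem theorem1p1 (R : realType) (p : nat -> R)
    (p01 : forall n : nat, 0 <= p n <= 1)
    (np_infty : (fun n : nat => n%:R * p n) @ \oo --> +oo) :
  exists C : R, 0 < C /\
    (fun n : nat =>
       gnp_prob (p n)
         (fun G : sgraph 'I_n =>
            n%:R - C * Num.sqrt (n%:R / p n) <= ((treedepth G)%:R : R) <= n%:R))
      @ \oo --> (1 : R).
Proof.
exists 4; split; first by [].
have lo : (fun n => 1 - (4 / 5) ^+ n) @ \oo --> (1 : R).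
  rewrite -[X in _ --> X]subr0; apply: cvgB; first exact: cvg_cst.
  by apply: cvg_expr; rewrite ger0_norm; lra.
apply: (@squeeze_cvgr _ _ _ _ _ (cst 1)); [|exact: lo|exact: cvg_cst].
(* Eventually [n * p n > 0], which gives the [p n > 0] required by the tail bound. *)
have /cvgryPgt/(_ 0) := np_infty; apply: filterS => n np_gt0.
have /andP[p0 p1] := p01 n.
have p_gt0 : 0 < p n.
  by rewrite lt_def p0 andbT; apply: contraTneq np_gt0 => ->; rewrite mulr0 ltxx.
(* Pass to the complement: as the tree-depth never exceeds [n], only the lower bound can fail. *)
rewrite gnp_probC lerD2l lerN2 gerBl; apply/andP; split.
  apply: le_trans (treedepth_tail n p_gt0 p1); apply: gnp_prob_le => // G /=.
  by rewrite ler_nat -[in X in (_ <= X)%N](card_ord n) treedepth_le_card andbT -ltNge.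
by apply: sumr_ge0 => G _; exact: gnp_mass_ge0.
Qed.
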